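(* $L_{wp}(k) \in \mathrm{S}^{>}$ for any $k \ge 2$.
   Context: For a finitely generated free group $\mathcal{G}^k=(G,\circ)$ of rank $k$ with basis $\Sigma=\{\sigma_1,\dots,\sigma_k,\sigma_1^{-1},\dots,\sigma_k^{-1}\}$ (used as the alphabet), the word problem language is $L_{wp}(k)=\{w=w_1\cdots w_{|w|}\in\Sigma^* \mid w_1\circ\cdots\circ w_{|w|}=\imath\}$, where $\imath$ is the identity element (free groups of equal rank are isomorphic, so this depends only on $k$). Let $\Gamma=\Sigma\cup\{¢,\$\}$, where ¢ and \$ are left and right end-markers. A PFA $\mathcal{P}=(S,\Sigma,\{\mathsf{A}_\sigma:\sigma\in\Gamma\},F)$ has states $S=\{s_1,\dots,s_n\}$ (start state $s_1$), real stochastic transition matrices $\mathsf{A}_\sigma$, and accepting states $F$; its acceptance probability on $w$ is $f_{\mathcal{P}}(w)=\sum_{s_i\in F}\mathsf{v}(i)$, $\mathsf{v}=(1,0,\dots,0)\mathsf{A}_{¢}\mathsf{A}_{w_1}\cdots\mathsf{A}_{w_{|w|}}\mathsf{A}_{\$}$. $\mathrm{S}^{>}$ (stochastic languages) is the class of languages $\{w:f_{\mathcal{P}}(w)>\lambda\}$ for a PFA $\mathcal{P}$ and $\lambda\in[0,1)$. *)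

(* Defs.v *)
From mathcomp Require Import all_boot all_order all_algebra.
From mathcomp Require Import classical_sets reals.

Set Implicit Arguments.
Unset Strict Implicit.
Unset Printing Implicit Defensive.

Import Order.TTheory GRing.Theory Num.Theory.

Local Open Scope classical_set_scope.
Local Open Scope ring_scope.

(* [sigma] freely generates [G]: every assignment of the generators to a group
   extends uniquely to a group morphism. *)
Definition free_basis (k : nat) (G : groupType) (sigma : 'I_k -> G) : Prop :=
  forall (H : groupType) (h : 'I_k -> H),
    exists2 phi : {multiplicative G -> H},
      (forall i, phi (sigma i) = h i)
      & forall psi : {multiplicative G -> H},
          (forall i, psi (sigma i) = h i) -> psi =1 phi.

(* The alphabet [Sigma]: [(i, false)] is the letter [sigma_i] and [(i, true)]
   the letter [sigma_i^-1]. *)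
Definition letter (k : nat) : finType := ('I_k * bool)%type.

Definition letter_val (k : nat) (G : groupType) (sigma : 'I_k -> G)
    (a : letter k) : G :=
  if a.2 then (sigma a.1)^-1%g else sigma a.1.

Definition word_problem (k : nat) (G : groupType) (sigma : 'I_k -> G) :
    set (seq (letter k)) :=
  [set w | (\prod_(a <- w) letter_val sigma a)%g = 1%g].

Inductive tape_symbol (A : Type) : Type :=
| LeftMarker
| Letter of A
| RightMarker.

Arguments LeftMarker {A}.
Arguments RightMarker {A}.

(* Row-stochastic, since state distributions are row vectors. *)
Definition stochastic_mx (R : realType) (n : nat) (M : 'M[R]_n) : Prop :=
  (forall i j, 0 <= M i j) /\ (forall i, \sum_j M i j = 1).

(* The states are ['I_(pfa_size.+1)]; the start state is [0]. *)
Record pfa (R : realType) (A : finType) := PFA {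
  pfa_size : nat;
  pfa_trans : tape_symbol A -> 'M[R]_pfa_size.+1;
  pfa_final : {set 'I_pfa_size.+1};
  pfa_stochastic : forall s, stochastic_mx (pfa_trans s)
}.

Definition pfa_final_vec (R : realType) (A : finType) (P : pfa R A)
    (w : seq A) : 'rV[R]_(pfa_size P).+1 :=
  delta_mx 0 0 *m pfa_trans P LeftMarker
    *m (\prod_(a <- w) pfa_trans P (Letter a))
    *m pfa_trans P RightMarker.

Definition accept_prob (R : realType) (A : finType) (P : pfa R A)
    (w : seq A) : R :=
  \sum_(i in pfa_final P) pfa_final_vec P w 0 i.

(* The class S^> of stochastic languages over [A]. *)
Definition stochastic_languages (R : realType) (A : finType) :
    set (set (seq A)) :=
  [set L | exists (P : pfa R A) (lambda : R),
     0 <= lambda < 1 /\ L = [set w | lambda < accept_prob P w]].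

Arguments stochastic_languages R A : clear implicits.

(* Main.v *)
(** The matrices [shear (2i) 3], for [i < k], play ping-pong on row vectors
    [(p, q)]: putting [u = p - 2iq], the letter [sigma_i^s] sends [(u, q)] to
    [(u, q + 3su)], and the regions [|p - 2iq| < |q|] are disjoint for distinct
    [i]. Hence a nonempty reduced word sends [(1, 0)] into one of these regions,
    on which the quadratic form [p^2 - (2k)^2 q^2] is negative, while the
    identity gives the value [1]. Acting on the symmetric matrix [v^T v] turns
    this form into the value of a weighted automaton, positive exactly on the
    word problem. Finally a weighted automaton with matrices [A] is simulated by
    the stochastic matrices [J + c [A, -A; -A, A]], where [J] is uniform: the
    two summands annihilate each other, so the cut point is an entry of [J]. *)
Require Import Defs.
From HB Require Import structures.
From mathcomp Require Import all_boot all_order all_algebra.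
From mathcomp Require Import boolp classical_sets reals.
From mathcomp Require Import ring lra.

Set Implicit Arguments.
Unset Strict Implicit.
Unset Printing Implicit Defensive.

Import Order.TTheory GRing.Theory Num.Theory.

Local Open Scope classical_set_scope.
Local Open Scope ring_scope.

(** * Simulating weighted automata by stochastic ones *)

Section Turakainen.
Variables (R : realType) (n : nat).
Local Notation N := (n.+1 + n.+1)%N.

Definition perturbed_uniform_mx (B : 'M[R]_n.+1) : 'M[R]_N :=
  const_mx N%:R^-1 + block_mx B (- B) (- B) B.

(** The uniform part [J] is idempotent, and it kills the block part on both sides because the rows
    and columns of the latter sum to zero. The factor 2 is [B C + (-B)(-C)]. *)
Lemma perturbed_uniform_mxM (B C : 'M[R]_n.+1) :
  perturbed_uniform_mx B *m perturbed_uniform_mx C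
  = perturbed_uniform_mx (2 *: (B *m C)).
Proof.
rewrite /perturbed_uniform_mx mulmxDl !mulmxDr.
pose J : 'M[R]_N := const_mx N%:R^-1; rewrite -/J.
have JJ : J *m J = J.
  apply/matrixP=> i j; rewrite !mxE.
  under eq_bigr do rewrite !mxE.
  by rewrite sumr_const card_ord -[LHS]mulr_natr mulfVK // pnatr_eq0.
have JB : J *m block_mx C (- C) (- C) C = 0.
  have -> : J = row_mx (const_mx N%:R^-1) (const_mx N%:R^-1).
    by rewrite /J row_mx_const.
  by rewrite mul_row_block !mulmxN subrr addNr row_mx0.
have BJ : block_mx B (- B) (- B) B *m J = 0.
  have -> : J = col_mx (const_mx N%:R^-1) (const_mx N%:R^-1).
    by rewrite /J col_mx_const.
  by rewrite mul_block_col !mulNmx subrr addNr col_mx0.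
rewrite JJ JB BJ addr0 add0r mulmx_block !mulNmx !mulmxN !opprK.
by rewrite -opprD -!mulr2n -!scaler_nat.
Qed.

Lemma perturbed_uniform_mx00 (B : 'M[R]_n.+1) :
  perturbed_uniform_mx B 0 0 = N%:R^-1 + B 0 0.
Proof.
have -> : (0 : 'I_N) = lshift n.+1 (0 : 'I_n.+1) by apply/val_inj.
by rewrite /perturbed_uniform_mx mxE block_mxEul mxE.
Qed.

Lemma perturbed_uniform_mx_stochastic (B : 'M[R]_n.+1) :
  (forall i j, `|B i j| <= N%:R^-1) -> stochastic_mx (perturbed_uniform_mx B).
Proof.
move=> Bs; split=> [i j|i].
  rewrite /perturbed_uniform_mx !mxE.
  case: splitP => i' _; rewrite mxE; case: splitP => j' _; rewrite ?mxE;
    by move: (Bs i' j'); rewrite ler_norml => /andP[]; lra.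
rewrite /perturbed_uniform_mx.
under eq_bigr do rewrite mxE [const_mx _ _ _]mxE.
rewrite big_split /= sumr_const card_ord -[_ *+ N]mulr_natr mulVf ?pnatr_eq0 //.
rewrite big_split_ord /= -[RHS]addr0; congr (_ + _).
rewrite -big_split big1 // => j _ /=; rewrite -(splitK i).
by case: (split i) => i' /=;
  rewrite ?block_mxEul ?block_mxEur ?block_mxEdl ?block_mxEdr !mxE;
  rewrite ?subrr ?addNr.
Qed.

(** The summand 1 covers [B = 0]; the factor [N] keeps the scaled entries below those of the uniform
    matrix. *)
Definition damping (B : 'M[R]_n.+1) : R :=
  (N%:R * (1 + \sum_i \sum_j `|B i j|))^-1.

Lemma damping_gt0 (B : 'M[R]_n.+1) : 0 < damping B.
Proof.
rewrite invr_gt0 mulr_gt0 ?ltr0n // ltr_wpDr //.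
by apply: sumr_ge0 => i _; apply: sumr_ge0.
Qed.

Lemma damping_le (B : 'M[R]_n.+1) i j : `|(damping B *: B) i j| <= N%:R^-1.
Proof.
rewrite mxE normrM gtr0_norm ?damping_gt0 // /damping.
have s_ge0 : 0 <= \sum_i \sum_j `|B i j|.
  by apply: sumr_ge0 => ? _; apply: sumr_ge0.
rewrite invfM -mulrA ler_piMr ?invr_ge0 ?ler0n //.
rewrite mulrC ler_pdivrMr ?mul1r; last by rewrite ltr_wpDr.
apply: ler_wpDl => //; apply: (@le_trans _ _ (\sum_j' `|B i j'|)).
  by rewrite (bigD1 j) //= lerDl sumr_ge0.
by rewrite [leRHS](bigD1 i) //= lerDl sumr_ge0 // => ? _; apply: sumr_ge0.
Qed.

Lemma weighted_automaton_stochastic (A : finType) (u : 'rV[R]_n.+1)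
    (M : A -> 'M[R]_n.+1) (f : 'cV[R]_n.+1) :
  stochastic_languages R A
    [set w | 0 < (u *m (\prod_(a <- w) M a) *m f) 0 0].
Proof.
(* Every row of the left-marker matrix is [u] and every column of the right-marker one is [f], so
   each entry of the full product is the weight of the word. *)
pose V (s : tape_symbol A) : 'M[R]_n.+1 := match s with
  | LeftMarker => const_mx 1 *m u
  | Letter a => M a
  | RightMarker => f *m const_mx 1
  end.
pose T s := perturbed_uniform_mx (damping (V s) *: V s).
have Tst s : stochastic_mx (T s).
  exact: perturbed_uniform_mx_stochastic (damping_le _).
pose P : pfa R A := @PFA R A (n + n.+1)%N T [set 0]%SET Tst.
(* The damping varies with the letter but accumulates into a positive factor, so the sign of the
   weight survives. *)
have prodT w : exists2 c : R, 0 < c &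
    T LeftMarker *m (\prod_(a <- w) T (Letter a))
    = perturbed_uniform_mx (c *: (V LeftMarker *m \prod_(a <- w) M a)).
  elim/last_ind: w => [|w a [c c0 IHw]].
    by exists (damping (V LeftMarker)); rewrite ?damping_gt0 // !big_nil !mulmx1.
  exists (2 * (c * damping (M a))); first by rewrite !mulr_gt0 ?damping_gt0.
  rewrite !big_rcons /= -[_ * T _]/(_ *m T _) mulmxA IHw perturbed_uniform_mxM.
  by rewrite -[_ * M a]/(_ *m M a) -scalemxAr -scalemxAl mulmxA !scalerA [_ * c]mulrC.
exists P, N%:R^-1; split.
  by rewrite invr_ge0 ler0n /= invf_lt1 ?ltr0n // ltr1n addnS.
apply/funext => w; apply/propext => /=.
have VE : (V LeftMarker *m \prod_(a <- w) M a *m V RightMarker) 0 0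
    = (u *m \prod_(a <- w) M a *m f) 0 0.
  rewrite /V; have -> : const_mx 1 *m u *m \prod_(a <- w) M a *m (f *m const_mx 1)
      = const_mx 1 *m (u *m \prod_(a <- w) M a *m f) *m const_mx 1 :> 'M_n.+1.
    by rewrite !mulmxA.
  by rewrite mxE big_ord1 mxE big_ord1 [const_mx _ _ _]mxE [const_mx _ _ _]mxE mul1r mulr1.
have [c c0 Ec] := prodT w.
rewrite -VE /accept_prob /= big_set1 /pfa_final_vec /=.
rewrite -(mulmxA _ (T LeftMarker)) Ec -(mulmxA _ _ (T _)) [T RightMarker]/T.
rewrite perturbed_uniform_mxM -rowE [row _ _ _ _]mxE perturbed_uniform_mx00 ltrDl.
rewrite -scalemxAr -scalemxAl !scalerA [fun_of_matrix (_ *: _) _ _]mxE pmulr_rgt0 //.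
by rewrite !mulr_gt0 ?damping_gt0.
Qed.
End Turakainen.

(** * Free reduction of words *)

Definition cancels (k : nat) (a b : letter k) := (a.1 == b.1) && (a.2 != b.2).

Definition reduced (k : nat) : seq (letter k) -> bool :=
  sorted (fun a b => ~~ cancels a b).

(** A single [w'] serves all groups, so it can be used in [G] and in the matrix group at once. *)
Lemma exists_reduced (k : nat) (w : seq (letter k)) :
  exists2 w', reduced w' &
    forall (G : groupType) (sigma : 'I_k -> G),
      (\prod_(a <- w) letter_val sigma a
       = \prod_(a <- w') letter_val sigma a)%g.
Proof.
elim: w => [|a w [[|b w'] red_w' eq_w]]; first by exists [::].
  by exists [:: a] => // G sigma; rewrite !big_cons eq_w.
have [/andP[/eqP eq1 neq2]|nab] := boolP (cancels a b).
  exists w' => [|G sigma]; first exact: path_sorted red_w'.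
  rewrite big_cons eq_w big_cons mulgA [X in (X * _)%g = _](_ : _ = 1%g) ?mul1g //.
  rewrite /letter_val eq1; move: neq2.
  by case: a.2; case: b.2 => // _; rewrite ?mulVg ?mulgV.
exists [:: a, b & w'] => [|G sigma]; first by rewrite /reduced /= nab.
by rewrite !big_cons eq_w big_cons.
Qed.

(** Packages invertible matrices as a [groupType], the kind of target that [free_basis] maps
    into. *)
Definition unit_group (U : unitRingType) := {x : U | x \is a GRing.unit}.

HB.instance Definition _ (U : unitRingType) := Choice.on (unit_group U).

Section UnitGroup.
Variable U : unitRingType.
Implicit Types x y z : unit_group U.

Let ug_one : unit_group U := exist _ 1 (unitr1 U).
Let ug_inv x : unit_group U := exist _ (val x)^-1 (etrans (unitrV _) (valP x)).
Let ug_mul x y : unit_group U :=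
  exist _ (val x * val y) (etrans (unitrMr _ (valP x)) (valP y)).

Let ug_mulA : associative ug_mul.
Proof. by move=> x y z; apply/val_inj; rewrite /= mulrA. Qed.
Let ug_mul1 : left_id ug_one ug_mul.
Proof. by move=> x; apply/val_inj; rewrite /= mul1r. Qed.
Let ug_mulr1 : right_id ug_one ug_mul.
Proof. by move=> x; apply/val_inj; rewrite /= mulr1. Qed.
Let ug_mulV : left_inverse ug_one ug_inv ug_mul.
Proof. by move=> x; apply/val_inj; rewrite /= mulVr ?(valP x). Qed.
Let ug_mulrV : right_inverse ug_one ug_inv ug_mul.
Proof. by move=> x; apply/val_inj; rewrite /= mulrV ?(valP x). Qed.

HB.instance Definition _ := isGroup.Build (unit_group U)
  ug_mulA ug_mul1 ug_mulr1 ug_mulV ug_mulrV.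

Lemma val_unit_group_prod (I : Type) (r : seq I) (F : I -> unit_group U) :
  val (\prod_(i <- r) F i)%g = \prod_(i <- r) val (F i).
Proof. exact: (big_morph val (fun _ _ => erefl) erefl). Qed.
End UnitGroup.

(* The parabolic map fixing the slope [p / q = c]. *)
Definition shear (R : realType) (c t : R) : 'M[R]_2 :=
  1 + t *: (\col_i (if i == 0 then 1 else - c) *m \row_j (if j == 0 then c else 1)).

(** * Ping-pong for shears of the plane *)

Section PingPong.
Variable R : realType.
Implicit Types (x : 'rV[R]_2) (c t : R).

Lemma mul_shear x c t :
  let u := x 0 0 - c * x 0 1 in
  ((x *m shear c t) 0 0 = x 0 0 + c * (t * u))
  * ((x *m shear c t) 0 1 = x 0 1 + t * u).
Proof.
have lift01 : lift ord0 ord0 = 1 :> 'I_2 by apply/val_inj.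
split; rewrite mulmxDr mulmx1 -scalemxAr mulmxA !mxE big_ord1 !mxE big_ord_recl
  big_ord1 !mxE lift01 /=; ring.
Qed.

(** The rank-one part squares to zero, since its row factor times its column factor is [c - c]. *)
Lemma shearM c s t : shear c s *m shear c t = shear c (s + t).
Proof.
rewrite /shear; set p := \col_i _; set q := \row_j _.
have qp : q *m p = 0.
  apply/matrixP=> i j; rewrite !mxE big_ord_recl big_ord1 !mxE /=; ring.
rewrite mulmxDl mul1mx mulmxDr mulmx1 -scalemxAl -scalemxAr -mulmxA (mulmxA q) qp.
by rewrite mul0mx mulmx0 !scaler0 addr0 scalerDl addrA addrAC.
Qed.

Lemma shear0 c : shear c 0 = 1.
Proof. by rewrite /shear scale0r addr0. Qed.

Lemma shear_unit c t : shear c t \is a GRing.unit.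
Proof.
by apply/unitrP; exists (shear c (- t)); split;
  rewrite -[LHS]/(_ *m _) shearM ?subrr ?addNr shear0.
Qed.

Lemma shearV c t : (shear c t)^-1 = shear c (- t).
Proof.
apply: (mulrI (shear_unit c t)); rewrite mulrV ?shear_unit //.
by rewrite -[RHS]/(_ *m _) shearM subrr shear0.
Qed.

Lemma ltr_norm_sqr (y z : R) : (`|y| < `|z|) = (y ^+ 2 < z ^+ 2).
Proof. by rewrite -ltr_sqr ?nnegrE // !real_normK ?num_real. Qed.

Lemma shift_dominates (q u d : R) : 2 <= `|d| -> `|u| < `|q| -> `|q| < `|u + d * q|.
Proof.
move=> d2 uq; have := lerB_normD (d * q) u; rewrite [d * q + u]addrC normrM.
have : 2 * `|q| <= `|d| * `|q| by apply: ler_wpM2r.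
lra.
Qed.

(** Here [3|u| - |q| > 2|u|], and the second product is [s u q + 3 u^2], whose last term
    dominates. *)
Lemma shear_dominates (q u s : R) : s ^+ 2 = 1 -> `|q| < `|u| ->
  (`|u| < `|q + 3 * s * u|) && (0 < s * u * (q + 3 * s * u)).
Proof.
rewrite !ltr_norm_sqr => /eqP; rewrite sqrf_eq1 => /orP[]/eqP-> qu.
  have q0 := sqr_ge0 q; have h := sqr_ge0 (u + q).
  by apply/andP; split; nra.
have q0 := sqr_ge0 q; have h := sqr_ge0 (u - q).
by apply/andP; split; nra.
Qed.

Section Letters.
Variable k : nat.
Implicit Types (a b : letter k) (w : seq (letter k)).

Definition letter_sign a : R := if a.2 then -1 else 1.

Definition letter_mx a : 'M[R]_2 := shear (2 * a.1)%:R (3 * letter_sign a).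

Lemma letter_sign_sqr a : letter_sign a ^+ 2 = 1.
Proof. by rewrite /letter_sign; case: a.2; rewrite ?sqrrN expr1n. Qed.

Definition offset a x : R := x 0 0 - (2 * a.1)%:R * x 0 1.

(** The sign condition separates a letter from its inverse: it makes a repetition of [a] increase
    [|q|] instead of possibly decreasing it. *)
Definition region a x : bool :=
  (`|offset a x| < `|x 0 1|) && (0 < letter_sign a * offset a x * x 0 1).

Lemma offset_mul_letter a x : offset a (x *m letter_mx a) = offset a x.
Proof. by rewrite /offset !mul_shear /=; ring. Qed.

Lemma snd_mul_letter a x :
  (x *m letter_mx a) 0 1 = x 0 1 + 3 * letter_sign a * offset a x.
Proof. by rewrite mul_shear. Qed.

Lemma region_enter a x : `|x 0 1| < `|offset a x| -> region a (x *m letter_mx a).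
Proof.
by move=> lt_x; rewrite /region offset_mul_letter snd_mul_letter;
  apply: shear_dominates; rewrite ?letter_sign_sqr.
Qed.

Lemma region_step a b x : ~~ cancels a b -> region a x -> region b (x *m letter_mx b).
Proof.
rewrite /cancels negb_and negbK => nab /andP[lt_x pos].
(* With equal generators, no cancellation forces [a = b], and the added term [3su] has the sign of
   [q]. *)
have [eq1|neq1] := eqVneq a.1 b.1.
  move: nab; rewrite eq1 eqxx /= => /eqP eq2.
  have <- : a = b by case: a b eq1 eq2 {lt_x pos} => [? ?] [? ?] /= -> ->.
  rewrite /region offset_mul_letter snd_mul_letter.
  move: lt_x pos; rewrite !ltr_norm_sqr.
  set s := letter_sign a; set u := offset a x; set q := x 0 1 => lt_x pos.
  have u0 := sqr_ge0 u.
  have : s ^+ 2 == 1 by rewrite letter_sign_sqr.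
  by rewrite sqrf_eq1 => /orP[]/eqP s1; move: pos; rewrite s1 => pos;
    apply/andP; split; nra.
apply: region_enter.
(* Slopes of distinct generators differ by at least 2, so the offset for [b] exceeds [|q|] and [b]
   enters its region afresh. *)
have -> : offset b x = offset a x + ((2 * a.1)%:R - (2 * b.1)%:R) * x 0 1.
  by rewrite /offset; ring.
apply: shift_dominates => //.
move: neq1; clear; wlog lt_ab : a b / (a.1 < b.1)%N => [hw|_].
  by rewrite -val_eqE neq_ltn => /orP[lt|lt]; last rewrite distrC;
    apply: hw; rewrite // -val_eqE neq_ltn lt ?orbT.
rewrite distrC ger0_norm ?subr_ge0 ?ler_nat ?leq_mul2l ?(ltnW lt_ab) //.
by rewrite -natrB ?leq_mul2l ?(ltnW lt_ab) // -mulnBr ler_nat leq_pmulr ?subn_gt0.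
Qed.

Lemma region_word a w x : path (fun a b => ~~ cancels a b) a w -> region a x ->
  region (last a w) (x *m \prod_(b <- w) letter_mx b).
Proof.
elim: w a x => [|b w IHw] a x /=; first by rewrite big_nil mulmx1.
case/andP=> nab red_w Dx; rewrite big_cons -[_ * _]/(_ *m _) mulmxA.
exact: IHw red_w (region_step nab Dx).
Qed.

Definition base_vec : 'rV[R]_2 := delta_mx 0 0.

(** For every letter [(1, 0)] has offset 1 and second coordinate 0, so any first letter enters its
    region. *)
Lemma region_reduced a w :
  reduced (a :: w) -> region (last a w) (base_vec *m \prod_(b <- a :: w) letter_mx b).
Proof.
move=> red_w; rewrite big_cons -[_ * _]/(_ *m _) mulmxA.
apply: region_word red_w _; apply: region_enter.
by rewrite /offset !mxE /= mulr0 subr0 normr1 normr0.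
Qed.

Definition cone_mx : 'M[R]_2 :=
  \matrix_(i, j) (if i == j then if i == 0 then 1 else - (2 * k)%:R ^+ 2 else 0).

Lemma cone_formE x :
  (x *m cone_mx *m x^T) 0 0 = x 0 0 ^+ 2 - ((2 * k)%:R * x 0 1) ^+ 2.
Proof.
rewrite !mxE !big_ord_recl !big_ord0 !mxE !big_ord_recl !big_ord0 !mxE /=.
rewrite (_ : lift ord0 ord0 = 1); last exact/val_inj.
ring.
Qed.

(** With [i < k], [|p| <= |u| + 2i|q| < (2i+1)|q| <= 2k|q|]. *)
Lemma cone_form_region_lt0 a x : region a x -> (x *m cone_mx *m x^T) 0 0 < 0.
Proof.
case/andP=> lt_x _; rewrite cone_formE subr_lt0 -ltr_norm_sqr normrM normr_nat.
have -> : x 0 0 = offset a x + (2 * a.1)%:R * x 0 1 by rewrite /offset; ring.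
apply: le_lt_trans (ler_normD _ _) _; rewrite normrM normr_nat.
apply: (@lt_le_trans _ _ ((2 * a.1).+1%:R * `|x 0 1|)).
  by rewrite -natr1 mulrDl mul1r addrC ltrD2l.
by rewrite ler_wpM2r // ler_nat !mul2n ltn_double.
Qed.

(** The map sending [Y] to [M^T Y M], in the coordinates of [mxvec]. *)
Definition sym_square_mx (M : 'M[R]_2) : 'M[R]_(2 * 2) :=
  lin_mulmx M^T *m lin_mulmxr M.

Lemma mul_sym_square x (M : 'M[R]_2) :
  mxvec (x^T *m x) *m sym_square_mx M = mxvec ((x *m M)^T *m (x *m M)).
Proof.
by rewrite /sym_square_mx [LHS]mulmxA !mul_vec_lin /= trmx_mul !mulmxA.
Qed.

Lemma mul_sym_square_prod (A : Type) x (M : A -> 'M[R]_2) (w : seq A) :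
  mxvec (x^T *m x) *m (\prod_(a <- w) sym_square_mx (M a) : 'M_4)
  = mxvec ((x *m \prod_(a <- w) M a)^T *m (x *m \prod_(a <- w) M a)).
Proof.
elim: w x => [|a w IHw] x; first by rewrite !big_nil !mulmx1.
rewrite !big_cons -[sym_square_mx _ * _]/(_ *m _) [LHS]mulmxA.
rewrite (mul_sym_square x (M a)) IHw.
by rewrite -[M a * _]/(_ *m _) !mulmxA.
Qed.

End Letters.
End PingPong.

(** * The word problem as positivity of a quadratic form *)

Section WordProblem.
Variables (R : realType) (k : nat) (G : groupType) (sigma : 'I_k -> G).

Definition ping_pong_unit (i : 'I_k) : unit_group 'M[R]_2 :=
  exist _ (letter_mx R (i, false)) (shear_unit _ _).

Lemma val_letter_ping_pong (a : letter k) :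
  val (letter_val ping_pong_unit a) = letter_mx R a.
Proof.
by case: a => i [] //; rewrite /letter_val /= shearV /letter_mx /letter_sign
  /= mulr1 mulrN1.
Qed.

(** Freeness extends the assignment of shears to generators to a morphism, which carries the
    relation over to matrices. *)
Lemma free_word_mx (w : seq (letter k)) : free_basis sigma ->
  (\prod_(a <- w) letter_val sigma a)%g = 1%g ->
  \prod_(a <- w) letter_mx R a = 1.
Proof.
move=> /(_ _ ping_pong_unit)[phi phi_sigma _] w1.
have phi1 : phi 1%g = 1%g by apply: (mulgI (phi 1%g)); rewrite -gmulfM !mulg1.
have phiV x : phi (x^-1)%g = (phi x)^-1%g.
  by apply: (mulgI (phi x)); rewrite -gmulfM !mulgV phi1.
have phi_letter a : phi (letter_val sigma a) = letter_val ping_pong_unit a.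
  by rewrite /letter_val; case: a.2; rewrite ?phiV phi_sigma.
have : val (phi (\prod_(a <- w) letter_val sigma a)%g) = 1 by rewrite w1 phi1.
rewrite (big_morph phi (@gmulfM _ _ phi) phi1) val_unit_group_prod => E; rewrite -[RHS]E.
by apply: eq_bigr => a _; rewrite phi_letter val_letter_ping_pong.
Qed.

Lemma word_problem_cone_form (w : seq (letter k)) : free_basis sigma ->
  let x := base_vec R *m \prod_(a <- w) letter_mx R a in
  (\prod_(a <- w) letter_val sigma a)%g = 1%g
  <-> 0 < (x *m cone_mx R k *m x^T) 0 0.
Proof.
move=> hG; have form_base : 0 < (base_vec R *m cone_mx R k *m (base_vec R)^T) 0 0.
  by rewrite cone_formE !mxE /= mulr0 expr0n subr0 expr1n.
split=> [w1|]; first by rewrite free_word_mx // mulmx1.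
have [[|a w'] red_w' eq_w] := exists_reduced w; first by rewrite eq_w big_nil.
(* The reduction is also valid in [unit_group], so [w] and its nonempty reduced form have the same
   matrix. *)
have -> : \prod_(b <- w) letter_mx R b = \prod_(b <- a :: w') letter_mx R b.
  transitivity (val (\prod_(b <- w) letter_val ping_pong_unit b)%g).
    by rewrite val_unit_group_prod; under [RHS]eq_bigr do rewrite val_letter_ping_pong.
  rewrite eq_w val_unit_group_prod.
  by apply: eq_bigr => b _; rewrite val_letter_ping_pong.
by rewrite ltNge ltW // (cone_form_region_lt0 (region_reduced R red_w')).
Qed.
End WordProblem.

Theorem theorem4p4 (R : realType) (k : nat) (hk : (2 <= k)%N)
    (G : groupType) (sigma : 'I_k -> G) (hG : free_basis sigma) :
  stochastic_languages R (letter k) (word_problem sigma).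
Proof.
have := @weighted_automaton_stochastic R 3 (letter k)
  (mxvec ((base_vec R)^T *m base_vec R)) (fun a => sym_square_mx (letter_mx R a))
  (mxvec (cone_mx R k))^T.
congr (stochastic_languages _ _ _); apply/funext => w; apply/propext => /=.
(* Pairing the vectorised [x^T x] with the vectorised [cone_mx] gives the form at [x]; the automaton
   has [3.+1 = 2 * 2] states. *)
rewrite /word_problem /= (word_problem_cone_form R) //
  -[base_vec R *m _ *m cone_mx R k *m _]mxvec_dotmul.
by rewrite -(mul_sym_square_prod (base_vec R) (fun a => letter_mx R a)).
Qed.
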